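(* If $G$ is an ambitable topological group then $\mathbf{M_u}(rG)=\Lambda(\mathbf{M}(rG))$ and $\widehat{rG}=\Lambda(\overline{rG})$.
   Context: All topological groups are assumed to be Hausdorff, and linear spaces are over $\mathbb{R}$. For a topological group $G$, $\mathcal{RP}(G)$ denotes the set of all continuous right-invariant pseudometrics $\Delta$ on $G$ (right-invariant: $\Delta(xz,yz)=\Delta(x,y)$ for all $x,y,z\in G$). The right uniformity on $G$ is the uniformity generated by $\mathcal{RP}(G)$; $G$ with this uniformity is denoted $rG$. $\mathbf{U_b}(rG)$ is the space of all bounded uniformly continuous real-valued functions on $rG$ (with the sup norm). For a pseudometric $\Delta$ on $G$, $\mathrm{BLip}^+(\Delta)=\{f:G\to\mathbb{R} \mid 0\le f(x)\le 1 \text{ and } |f(x)-f(y)|\le \Delta(x,y) \text{ for all } x,y\in G\}$, always considered with the topology of pointwise convergence (as a subspace of $\mathbb{R}^G$). For $f:G\to\mathbb{R}$ and $x\in G$, $\rho^x(f)$ is the function $z\mapsto f(zx)$; $\mathrm{orb}(f)=\{\rho^x(f)\mid x\in G\}$, and $\overline{\mathrm{orb}(f)}$ is its closure in $\mathbb{R}^G$. $G$ is ambitable if for each $\Delta\in\mathcal{RP}(G)$ there exists $f\in\mathbf{U_b}(rG)$ such that $\mathrm{BLip}^+(\Delta)\subseteq\overline{\mathrm{orb}(f)}$. $\mathbf{M}(rG)$ is the norm dual of $\mathbf{U_b}(rG)$. $\mathbf{M_u}(rG)$ is the subspace of those $\mu\in\mathbf{M}(rG)$ that are continuous on $\mathrm{BLip}^+(\Delta)$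 for each $\Delta\in\mathcal{RP}(G)$. For $x\in G$, $\delta_x\in\mathbf{M}(rG)$ is given by $\delta_x(f)=f(x)$. For $\mu,\nu\in\mathbf{M}(rG)$ the convolution $\mu\star\nu\in\mathbf{M}(rG)$ is defined by $(\mu\star\nu)(f)=\mu\bigl(x\mapsto\nu(y\mapsto f(xy))\bigr)$ for $f\in\mathbf{U_b}(rG)$. $\overline{rG}$ is the weak$^*$ closure of $\{\delta_x\mid x\in G\}$ in $\mathbf{M}(rG)$, with the weak$^*$ topology and the operation $\star$. $\widehat{rG}=\overline{rG}\cap\mathbf{M_u}(rG)$ (it is a completion of $rG$). $\mathbf{M}(rG)$ with $\star$ and the weak$^*$ topology, and its subsemigroup $\overline{rG}$, are right topological semigroups, i.e. $x\mapsto xy$ is continuous for each $y$. For a right topological semigroup $S$, its topological centre is $\Lambda(S)=\{x\in S\mid \text{the mapping } y\mapsto xy \text{ is continuous on } S\}$. *)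

(* Defs.v *)
From HB Require Import structures.
From mathcomp Require Import all_boot all_order all_algebra.
From mathcomp Require Import all_classical all_reals all_analysis.

Set Implicit Arguments.
Unset Strict Implicit.
Unset Printing Implicit Defensive.

Import Order.TTheory GRing.Theory Num.Theory.
Import numFieldNormedType.Exports.

Local Open Scope classical_set_scope.
Local Open Scope ring_scope.

HB.mixin Record isTopologicalGroup G of Topological G & Group G := {
  mulg_continuous : continuous (fun p : G * G => (p.1 * p.2)%g) ;
  invg_continuous : continuous (fun x : G => (x^-1)%g)
}.

#[short(type="topologicalGroupType")]
HB.structure Definition TopologicalGroup :=
  {G of Topological G & Group G & isTopologicalGroup G}.

(* The carrier of G, to be equipped with the uniformity generated by the
   R-valued pseudometrics in RP. *)
Definition rG (R : realType) (G : topologicalGroupType) : Type := G.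

Section RightUniformity.
Variables (R : realType) (G : topologicalGroupType).
Local Notation rG := (rG R G).
Implicit Types (D : G -> G -> R) (x y z : G).

Record RP D : Prop := MkRP {
  RP_ge0 : forall x y, 0 <= D x y ;
  RP_refl : forall x, D x x = 0 ;
  RP_sym : forall x y, D x y = D y x ;
  RP_triangle : forall x y z, D x z <= D x y + D y z ;
  RP_invariant : forall x y z, D (x * z)%g (y * z)%g = D x y ;
  RP_continuous : continuous (fun p : G * G => D p.1 p.2)
}.

Lemma RP0 : RP (fun _ _ => 0).
Proof.
by split=> *; rewrite ?addr0 ?lexx //; exact: cvg_cst.
Qed.

Lemma RP_max D1 D2 : RP D1 -> RP D2 ->
  RP (fun x y => Num.max (D1 x y) (D2 x y)).
Proof.
move=> d1 d2; split=> [x y|x|x y|x y z|x y z|p].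
- by rewrite le_max (RP_ge0 d1).
- by rewrite (RP_refl d1) (RP_refl d2) maxxx.
- by rewrite (RP_sym d1) (RP_sym d2).
- rewrite ge_max; apply/andP; split.
    by apply: le_trans (RP_triangle d1 x y z) _; rewrite lerD// le_max lexx.
  by apply: le_trans (RP_triangle d2 x y z) _;
     rewrite lerD// le_max lexx orbT.
- by rewrite (RP_invariant d1) (RP_invariant d2).
- by apply: continuous_max; [exact: RP_continuous d1 p|exact: RP_continuous d2 p].
Qed.

Lemma RP_ltrans D x : RP D -> RP (fun y z => D (x * y)%g (x * z)%g).
Proof.
move=> d; split=> [y z|y|y z|y z w|y z w|p].
- exact: RP_ge0 d _ _.
- exact: RP_refl d _.
- exact: RP_sym d _ _.
- exact: RP_triangle d _ _ _.
- by rewrite !mulgA; exact: RP_invariant d _ _ _.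
- have mulx : continuous (fun y : G => (x * y)%g).
    move=> y; apply: (@continuous_comp _ _ _ (fun z : G => (x, z))
      (fun q : G * G => (q.1 * q.2)%g)); last exact: mulg_continuous.
    by apply: cvg_pair; [exact: cvg_cst|exact: cvg_id].
  apply: (@continuous_comp _ _ _
    (fun q : G * G => ((x * q.1)%g, (x * q.2)%g))
    (fun q : G * G => D q.1 q.2)); last exact: RP_continuous d _.
  apply: cvg_pair.
    by apply: (@continuous_comp _ _ _ fst (fun y : G => (x * y)%g));
      [exact: cvg_fst|exact: mulx].
  by apply: (@continuous_comp _ _ _ snd (fun y : G => (x * y)%g));
    [exact: cvg_snd|exact: mulx].
Qed.

(* Finite intersections are not needed in the basis because RP is closed under
   maxima. *)
Definition right_entourage : set_system (rG * rG) :=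
  [set E | exists D, exists2 e : R,
     RP D /\ 0 < e & [set p | D p.1 p.2 < e] `<=` E].

Local Lemma right_entourage_filter : Filter right_entourage.
Proof.
split.
- by exists (fun _ _ => 0), 1 => //; split=> //; exact: RP0.
- move=> A B [D1 [e1 [d1 e1_gt0] sA]] [D2 [e2 [d2 e2_gt0] sB]].
  exists (fun x y => Num.max (D1 x y) (D2 x y)), (Num.min e1 e2).
    by split; [exact: RP_max|rewrite lt_min e1_gt0].
  move=> p /=; rewrite gt_max !lt_min => /andP[/andP[? _] /andP[_ ?]].
  by split; [exact: sA|exact: sB].
- by move=> A B AB [D [e de sA]]; exists D, e => //; exact: subset_trans AB.
Qed.

Local Open Scope relation_scope.

Local Lemma right_entourage_refl A : right_entourage A -> diagonal `<=` A.
Proof.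
move=> [D [e [d e_gt0] sA]] [x y] /= xy.
by have {xy}-> : x = y := xy; apply: sA; rewrite /= (RP_refl d).
Qed.

Local Lemma right_entourage_inv A : right_entourage A -> right_entourage A^-1.
Proof.
move=> [D [e [d e_gt0] sA]]; exists D, e => // -[x y] /= xy.
by apply: sA => /=; rewrite (RP_sym d).
Qed.

Local Lemma right_entourage_split A : right_entourage A ->
  exists2 B, right_entourage B & B \; B `<=` A.
Proof.
move=> [D [e [d e_gt0] sA]]; exists [set p | D p.1 p.2 < e / 2].
  by exists D, (e / 2) => //; split=> //; rewrite divr_gt0.
move=> [x z] /= [y /= xy yz]; apply: sA => /=.
by rewrite (le_lt_trans (RP_triangle d x y z))// [e]splitr ltrD.
Qed.

Local Close Scope relation_scope.

HB.instance Definition _ := Choice.on rG.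
HB.instance Definition _ := isUniform.Build rG right_entourage_filter
  right_entourage_refl right_entourage_inv right_entourage_split.

Lemma rG_unif_continuousP (f : rG -> R) : unif_continuous f <->
  forall e : R, 0 < e -> exists D, exists2 d : R,
    RP D /\ 0 < d & forall x y, D x y < d -> `|f x - f y| < e.
Proof.
split=> [uf e e_gt0|uf A].
  have /uf [D [d Dd sD]] : entourage [set p : R * R | `|p.1 - p.2| < e].
    by rewrite -entourage_ballE; exists e.
  by exists D, d => // x y xy; exact: (sD (x, y)).
rewrite -entourage_ballE => -[e /= e_gt0 sA].
have [D [d Dd fD]] := uf _ e_gt0.
by exists D, d => // -[x y] /= /fD xy; exact: sA.
Qed.

End RightUniformity.

Section Ub.
Variables (R : realType) (G : topologicalGroupType).
Local Notation rG := (rG R G).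

Definition Ub_pred : {pred rG -> R} :=
  mem [set f : rG -> R | unif_continuous f /\ bounded_fun f].

Lemma bounded_funE (f : rG -> R) :
  bounded_fun f <-> exists M, forall x, `|f x| <= M.
Proof.
have ? := @globally_properfilter rG setT (1%g : G) I.
split=> [/ex_bound[M fM]|[M fM]]; first by exists M => x; exact: fM.
by apply/ex_bound; exists M => x _; exact: fM.
Qed.

Lemma Ub_predP (f : rG -> R) : f \in Ub_pred <->
  unif_continuous f /\ exists M, forall x, `|f x| <= M.
Proof.
rewrite inE/=; split=> -[uf /bounded_funE bf]; first by split.
by split=> //; exact/bounded_funE.
Qed.

Fact Ub_submod_closed : submod_closed Ub_pred.
Proof.
split.
  apply/Ub_predP; split; last by exists 0 => x; rewrite normr0.
  apply/rG_unif_continuousP => e e_gt0; exists (fun _ _ => 0), 1.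
    by split; [exact: RP0|].
  by move=> x y _; rewrite subrr normr0.
move=> a f g /Ub_predP[/rG_unif_continuousP uf [M fM]].
move=> /Ub_predP[/rG_unif_continuousP ug [N gN]]; apply/Ub_predP; split.
  apply/rG_unif_continuousP => e e_gt0.
  have a_gt0 : 0 < `|a| + 1 by rewrite ltr_wpDl.
  have [|D1 [d1 [D1P d1_gt0] fD]] := uf (e / 2 / (`|a| + 1)).
    by rewrite !divr_gt0.
  have [|D2 [d2 [D2P d2_gt0] gD]] := ug (e / 2); first by rewrite divr_gt0.
  exists (fun x y => Num.max (D1 x y) (D2 x y)), (Num.min d1 d2).
    by split; [exact: RP_max|rewrite lt_min d1_gt0].
  move=> x y; rewrite gt_max !lt_min => /andP[/andP[/fD f1 _] /andP[_ /gD g1]].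
  rewrite [X in `|X|](_ : _ = a * (f x - f y) + (g x - g y)); last first.
    by rewrite mulrBr addrACA -opprD.
  rewrite (le_lt_trans (ler_normD _ _))// [e]splitr ler_ltD// normrM.
  rewrite (@le_trans _ _ ((`|a| + 1) * `|f x - f y|))//.
    by rewrite ler_wpM2r// lerDl.
  by rewrite mulrC -ler_pdivlMr// ltW.
exists (`|a| * M + N) => x.
by rewrite (le_trans (ler_normD _ _))// lerD// normrM ler_wpM2l.
Qed.

HB.instance Definition _ :=
  GRing.isSubmodClosed.Build R (rG -> R) Ub_pred Ub_submod_closed.

Record Ub : Type := MkUb { Ub_val :> rG -> R ; Ub_valP : Ub_val \in Ub_pred }.

HB.instance Definition _ := [isSub for Ub_val].
HB.instance Definition _ := [Choice of Ub by <:].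
HB.instance Definition _ := [SubChoice_isSubLmodule of Ub by <:].

Definition Ub_norm (f : Ub) : R := sup (range (fun x : rG => `|f x|)).

Lemma Ub_norm_ge (f : Ub) (x : rG) : `|f x| <= Ub_norm f.
Proof.
apply: ub_le_sup; last by exists x.
have /Ub_predP[_ [M fM]] := Ub_valP f.
by exists M => _ [y _ <-].
Qed.

Lemma Ub_norm_le (f : Ub) (c : R) :
  (forall x : rG, `|f x| <= c) -> Ub_norm f <= c.
Proof.
move=> fc; apply: ge_sup; first by exists `|f 1%g|; exists 1%g.
by move=> _ [x _ <-].
Qed.

Lemma Ub_norm_ge0 (f : Ub) : 0 <= Ub_norm f.
Proof. exact: le_trans (normr_ge0 _) (Ub_norm_ge f 1%g). Qed.

Fact Ub_normD (f g : Ub) : Ub_norm (f + g) <= Ub_norm f + Ub_norm g.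
Proof.
apply: Ub_norm_le => x.
by rewrite (le_trans (ler_normD _ _))// lerD// Ub_norm_ge.
Qed.

Fact Ub_normZ (a : R) (f : Ub) : Ub_norm (a *: f) = `|a| * Ub_norm f.
Proof.
have leZ (b : R) (g : Ub) : Ub_norm (b *: g) <= `|b| * Ub_norm g.
  by apply: Ub_norm_le => x; rewrite normrM ler_wpM2l// Ub_norm_ge.
apply/eqP; rewrite eq_le leZ/=.
have [->|a0] := eqVneq a 0; first by rewrite normr0 mul0r Ub_norm_ge0.
rewrite -ler_pdivlMl ?normr_gt0// -normfV.
by rewrite -{1}[f](scalerK a0) leZ.
Qed.

Fact Ub_norm0_eq0 (f : Ub) : Ub_norm f = 0 -> f = 0.
Proof.
move=> f0; apply/val_inj/funext => x /=.
by apply/eqP; rewrite -normr_le0 -f0 Ub_norm_ge.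
Qed.

HB.instance Definition _ :=
  Lmodule_isNormed.Build R Ub Ub_normD Ub_normZ Ub_norm0_eq0.

End Ub.

Section Dual.
Variables (R : realType) (V : normedModType R).

Record norm_dual : Type := MkDual {
  dual_val :> {linear V -> R} ;
  dual_continuous : continuous dual_val
}.

HB.instance Definition _ := gen_eqMixin norm_dual.
HB.instance Definition _ := gen_choiceMixin norm_dual.

Lemma dual_eqP (mu nu : norm_dual) : (forall v, mu v = nu v) -> mu = nu.
Proof.
case: mu nu => [[m Hm] cm] [[n Hn] cn] /= /funext mn.
rewrite mn in Hm cm *; case: Hm Hn cm cn => [[a] [b]] [[c] [d]].
rewrite (Prop_irrelevance a c) (Prop_irrelevance b d) => cm cn.
by rewrite (Prop_irrelevance cm cn).
Qed.

Definition dual_ptws (mu : norm_dual) : {ptws V -> R} := mu : V -> R.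

(* The weak* topology: pointwise convergence on V. *)
HB.instance Definition _ := Topological.copy norm_dual (initial_topology dual_ptws).

Lemma dual_bound (mu : norm_dual) :
  exists2 c : R, 0 <= c & forall v, `|mu v| <= c * `|v|.
Proof.
have /linear_bounded_continuous/linear_boundedP := @dual_continuous mu.
move=> /pinfty_ex_gt0[c c_gt0 muc].
by exists c => //; exact: ltW.
Qed.

Lemma bounded_dual (mu : {linear V -> R}) (c : R) :
  (forall v, `|mu v| <= c * `|v|) -> continuous mu.
Proof.
move=> muc; apply/linear_bounded_continuous/linear_boundedP.
exists c; split=> [|r cr v]; first exact: num_real.
by rewrite (le_trans (muc v))// ler_wpM2r// ltW.
Qed.

End Dual.

Section Convolution.
Variables (R : realType) (G : topologicalGroupType).
Local Notation rG := (rG R G).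
Local Notation Ub := (Ub R G).

Fact ltrans_subproof (f : Ub) (x : G) :
  (fun y : G => f (x * y)%g) \in @Ub_pred R G.
Proof.
have /Ub_predP[/rG_unif_continuousP uf [M fM]] := Ub_valP f.
apply/Ub_predP; split; last by exists M.
apply/rG_unif_continuousP => e /uf[D [d [dD d_gt0] fD]].
exists (fun y z => D (x * y)%g (x * z)%g), d; first by split; [exact: RP_ltrans|].
by move=> y z; exact: fD.
Qed.

Definition ltrans (f : Ub) (x : G) : Ub := MkUb (ltrans_subproof f x).

Fact lconvol_subproof (nu : norm_dual Ub) (f : Ub) :
  (fun x : G => nu (ltrans f x)) \in @Ub_pred R G.
Proof.
have /Ub_predP[/rG_unif_continuousP uf [M fM]] := Ub_valP f.
have [c c_ge0 nuc] := dual_bound nu.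
apply/Ub_predP; split; last first.
  exists (c * `|f|) => x; rewrite (le_trans (nuc _))// ler_wpM2l//.
  by apply: Ub_norm_le => y; exact: Ub_norm_ge f (x * y)%g.
apply/rG_unif_continuousP => e e_gt0.
have c1_gt0 : 0 < c + 1 by rewrite ltr_wpDl.
have [|D [d [dD d_gt0] fD]] := uf (e / (c + 1)); first by rewrite divr_gt0.
exists D, d => // x z xz; rewrite -linearB/=.
rewrite (le_lt_trans (nuc _))//.
have le_e : `|ltrans f x - ltrans f z| <= e / (c + 1).
  by apply: Ub_norm_le => y; rewrite ltW//; apply: fD; rewrite (RP_invariant dD).
rewrite (le_lt_trans (ler_wpM2l c_ge0 le_e))// mulrCA gtr_pMr//.
by rewrite ltr_pdivrMr// mul1r ltrDl.
Qed.

Definition lconvol (nu : norm_dual Ub) (f : Ub) : Ub :=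
  MkUb (lconvol_subproof nu f).

Definition convol_val (mu nu : norm_dual Ub) (f : Ub) : R := mu (lconvol nu f).

Fact convol_val_linear (mu nu : norm_dual Ub) : linear (convol_val mu nu).
Proof.
move=> a f g; rewrite /convol_val -linearP; congr (mu _).
apply/val_inj/funext => x /=; rewrite -[RHS]/(a *: nu _ + nu _) -linearP.
by congr (nu _); exact/val_inj/funext.
Qed.

HB.instance Definition _ (mu nu : norm_dual Ub) :=
  GRing.isLinear.Build R Ub R *:%R (convol_val mu nu) (convol_val_linear mu nu).

Fact convol_continuous (mu nu : norm_dual Ub) : continuous (convol_val mu nu).
Proof.
have [c c_ge0 muc] := dual_bound mu; have [d d_ge0 nud] := dual_bound nu.
apply: (@bounded_dual _ _ _ (c * d)) => f; rewrite (le_trans (muc _))// -mulrA.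
rewrite ler_wpM2l//; apply: Ub_norm_le => x; rewrite (le_trans (nud _))//.
by rewrite ler_wpM2l//; apply: Ub_norm_le => y; exact: Ub_norm_ge f (x * y)%g.
Qed.

(* (mu * nu)(f) = mu (x |-> nu (y |-> f (x y))) *)
Definition convol (mu nu : norm_dual Ub) : norm_dual Ub :=
  MkDual (@convol_continuous mu nu).

Definition delta_val (x : G) (f : Ub) : R := f x.

Fact delta_val_linear (x : G) : linear (delta_val x).
Proof. by []. Qed.

HB.instance Definition _ (x : G) :=
  GRing.isLinear.Build R Ub R *:%R (delta_val x) (delta_val_linear x).

Fact delta_continuous (x : G) : continuous (delta_val x).
Proof. by apply: (@bounded_dual _ _ _ 1) => f; rewrite mul1r Ub_norm_ge. Qed.

Definition delta_dual (x : G) : norm_dual Ub := MkDual (@delta_continuous x).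

Definition rG_bar : set (norm_dual Ub) := closure (range delta_dual).

Lemma dual_continuousP (T : topologicalType) (h : T -> norm_dual Ub) :
  (forall f : Ub, continuous (fun t => h t f)) -> continuous h.
Proof.
move=> hf; apply: continuous_comp_initial => t.
by apply/pointwise_cvgP => f; exact: hf.
Qed.

Lemma dual_eval_continuous (f : Ub) : continuous (fun mu : norm_dual Ub => mu f).
Proof.
move=> mu; apply: (@continuous_comp _ _ _ (@dual_ptws R Ub)
  (fun h : {ptws Ub -> R} => h f)); first exact: initial_continuous.
exact: (@proj_continuous _ (fun _ => R) f).
Qed.

Lemma convol_continuousl (nu : norm_dual Ub) : continuous (convol ^~ nu).
Proof.
by apply: dual_continuousP => f; exact: (@dual_eval_continuous (lconvol nu f)).
Qed.

Lemma rG_bar_convol (mu nu : norm_dual Ub) :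
  rG_bar mu -> rG_bar nu -> rG_bar (convol mu nu).
Proof.
have img (h : norm_dual Ub -> norm_dual Ub) (A : set (norm_dual Ub)) : continuous h ->
    (forall m, A m -> rG_bar (h m)) -> closure A `<=` h @^-1` rG_bar.
  move=> hc hA m Am; apply: (@closed_closure _ (range delta_dual)) => U /hc hU.
  by have [n [An Un]] := Am _ hU; exists (h n); split=> //; exact: hA.
move=> rmu rnu; apply: (img _ _ (@convol_continuousl nu) _ _ rmu) => _ [x _ <-].
have dc : continuous (convol (delta_dual x)).
  by apply: dual_continuousP => f; exact: (@dual_eval_continuous (ltrans f x)).
apply: (img _ _ dc _ _ rnu) => _ [y _ <-]; apply: subset_closure.
by exists (x * y)%g => //; exact: dual_eqP.
Qed.

End Convolution.

Section Ambitable.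
Variables (R : realType) (G : topologicalGroupType).
Local Notation Ub := (Ub R G).

Definition BLip (D : G -> G -> R) : set (G -> R) :=
  [set f | (forall x, 0 <= f x <= 1) /\ forall x y, `|f x - f y| <= D x y].

Definition rho (x : G) (f : G -> R) : G -> R := fun z => f (z * x)%g.

Definition right_orbit (f : G -> R) : set (G -> R) :=
  [set rho x f | x in [set: G]].

Definition ambitable : Prop := forall D : G -> G -> R, RP D ->
  exists f : Ub, BLip D `<=` closure (right_orbit f : set {ptws G -> R}).

Lemma BLip_Ub (D : G -> G -> R) (f : G -> R) :
  RP D -> BLip D f -> f \in @Ub_pred R G.
Proof.
move=> dD [f01 fD]; apply/Ub_predP; split; last first.
  by exists 1 => x; have /andP[f0 f1] := f01 x; rewrite ger0_norm.
apply/rG_unif_continuousP => e e_gt0; exists D, e => // x y.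
exact: le_lt_trans.
Qed.

(* By BLip_Ub, restricting to elements of Ub loses nothing of BLip D. *)
Definition Ub_ptws (f : Ub) : {ptws G -> R} := f : G -> R.

Definition Mu : set (norm_dual Ub) :=
  [set mu : norm_dual Ub | forall D : G -> G -> R, RP D ->
    {within [set f : initial_topology Ub_ptws | BLip D f],
      continuous (mu : Ub -> R)}].

Definition rG_hat : set (norm_dual Ub) := @rG_bar R G `&` Mu.

End Ambitable.

Arguments convol R G : clear implicits.
Arguments rG_bar R G : clear implicits.
Arguments rG_hat R G : clear implicits.
Arguments Mu R G : clear implicits.

(* S is meant to be closed under op (see rG_bar_convol), so that continuity of
   op x on S with values in T is continuity with values in S. *)
Definition topological_centre (T : topologicalType) (op : T -> T -> T)
    (S : set T) : set T :=
  [set x | S x /\ {within S, continuous (op x)}].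

(* Main.v *)
From HB Require Import structures.
Require Import Defs.
From mathcomp Require Import all_boot all_order all_algebra.
From mathcomp Require Import all_classical all_reals all_analysis.
From mathcomp Require Import ring lra.

Set Implicit Arguments.
Unset Strict Implicit.
Unset Printing Implicit Defensive.

Import Order.TTheory GRing.Theory Num.Theory.
Import numFieldNormedType.Exports.

Local Open Scope classical_set_scope.
Local Open Scope ring_scope.

(** Write mu * nu for the convolution and call a set of measures bounded when
    it is bounded in norm.

    Measures in Mu are in the centre.  Fix f in Ub and let D_f be the
    right-invariant pseudometric D_f(x, y) = sup_z |f(xz) - f(yz)|.  For nu of
    norm at most b the function x |-> nu(f(x .)) is bounded and D_f-Lipschitz
    with constants that depend on b and f only, and it depends on nu pointwise
    weak* continuously.  As mu is continuous on BLip D_f, the map nu |-> (mu *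
    nu)(f) is weak* continuous at 0 on bounded sets of measures (convol_small).
    Continuity on the whole dual, where bounded sets need not be neighbourhoods,
    follows from a Fubini identity (convolE): (mu * nu)(f) = nu(g), where g(y) =
    (mu * delta_y)(f) lies in Ub.  The identity is clear for finite combinations
    of point masses, and every nu is a weak* limit of a bounded family of these
    (discretization): for a partition of unity phi_t subordinate to a finite
    cover of G on whose members the given finitely many functions are almost
    constant, take the masses nu(phi_t).

    Conversely let G be ambitable and nu |-> mu * nu continuous on the closure
    rG_bar of the point masses.  Given D in RP, choose f with BLip D contained
    in the closure of the right orbit of f.  The map Psi : nu |-> nu(f(x .)) is
    continuous from rG_bar to the functions of x with the pointwise topology,
    and it sends delta_y to the right translate rho^y f.  By the Alaoglu theorem
    rG_bar is compact, so Psi is a closed map and its image contains BLip D.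
    Since mu o Psi = (mu * .)(f) is continuous, mu is continuous on BLip D
    (convol_continuous_Mu).

    Both equalities follow, because continuity on all measures restricts to
    continuity on rG_bar. *)

(** * The pseudometric of uniform distance between left translates *)

Section TranslationDistance.
Variables (R : realType) (G : topologicalGroupType).
Local Notation Ub := (Ub R G).
Implicit Types (D : G -> G -> R) (f h : Ub) (mu nu : norm_dual Ub).

Definition ltrans_dist f (x y : G) : R := `|ltrans f x - ltrans f y|.

Lemma ltrans_dist_ge f x y : `|f x - f y| <= ltrans_dist f x y.
Proof.
have : `|f (x * 1)%g - f (y * 1)%g| <= ltrans_dist f x y :=
  Ub_norm_ge (ltrans f x - ltrans f y) 1%g.
by rewrite !mulg1.
Qed.

Lemma Ub_lipschitz D (u : G -> R) (b c : R) : RP D -> 0 <= c ->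
  (forall x, `|u x| <= b) -> (forall x y, `|u x - u y| <= c * D x y) ->
  u \in @Ub_pred R G.
Proof.
move=> dD c_ge0 ub uD; apply/Ub_predP; split; last by exists b.
apply/rG_unif_continuousP => e e_gt0.
have c1 : 0 < c + 1 by rewrite ltr_wpDl.
exists D, (e / (c + 1)); first by split=> //; rewrite divr_gt0.
move=> x y; rewrite ltr_pdivlMr// => xy; apply: le_lt_trans xy.
apply: le_trans (uD x y) _; rewrite mulrC ler_wpM2l ?lerDl//.
exact: RP_ge0 dD _ _.
Qed.

(** Right invariance is the substitution z := zw in sup_z |f(xz) - f(yz)|, and
    continuity is the uniform continuity of f on rG.  So a single element of RP
    witnesses the uniform continuity of f, with f itself 1-Lipschitz for it. *)
Lemma ltrans_dist_RP f : RP (ltrans_dist f).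
Proof.
have tri x y z : ltrans_dist f x z <= ltrans_dist f x y + ltrans_dist f y z.
  exact: ler_distD.
have sym x y : ltrans_dist f x y = ltrans_dist f y x by exact: distrC.
split=> //.
- by move=> x y; exact: normr_ge0.
- by move=> x; rewrite /ltrans_dist subrr normr0.
- have le_inv x y z : ltrans_dist f (x * z)%g (y * z)%g <= ltrans_dist f x y.
    apply: Ub_norm_le => w.
    rewrite -[X in `|X|]/(f (x * z * w)%g - f (y * z * w)%g).
    by rewrite -!mulgA; exact: (Ub_norm_ge (ltrans f x - ltrans f y) (z * w)%g).
  move=> x y z; apply/eqP; rewrite eq_le le_inv/=.
  by have := le_inv (x * z)%g (y * z)%g z^-1%g; rewrite -!mulgA mulgV !mulg1.
- move=> [x y] /=; apply/cvgrPdist_lt => e e_gt0.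
  have /Ub_predP[/rG_unif_continuousP uf _] := Ub_valP f.
  have [|D [d [dD d_gt0] fD]] := uf (e / 3); first by rewrite divr_gt0.
  have small (z w : G) : D z w < d -> ltrans_dist f z w <= e / 3.
    move=> zw; apply: Ub_norm_le => t; rewrite ltW//; apply: fD.
    by rewrite (RP_invariant dD).
  have near_d (z : G) : \forall w \near z, D z w < d.
    have Dz : (fun w => D z w) @ z --> D z z.
      apply: (@continuous_comp _ _ _ (fun w : G => (z, w))
        (fun p : G * G => D p.1 p.2)); last exact: RP_continuous dD _.
      by apply: cvg_pair; [exact: cvg_cst|exact: cvg_id].
    move: Dz; rewrite (RP_refl dD) => /cvgr_lt; exact.
  exists ([set w | D x w < d], [set w | D y w < d]) => //=.
    by split; exact: near_d.
  move=> [z w] /= [/small xz /small yw].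
  have := tri x z y; have := tri z w y; have := tri z x w; have := tri x y w.
  rewrite (sym z x) (sym w y) => H1 H2 H3 H4.
  rewrite ltr_norml; apply/andP; split; lra.
Qed.

Definition ltrans_dists (hs : seq Ub) (x y : G) : R :=
  \sum_(h <- hs) ltrans_dist h x y.

Lemma ltrans_dists_RP hs : RP (ltrans_dists hs).
Proof.
split=> [x y|x|x y|x y z|x y z|].
- by apply: sumr_ge0 => h _; exact: normr_ge0.
- by apply: big1 => h _; exact: RP_refl (ltrans_dist_RP h) _.
- by apply: eq_bigr => h _; exact: RP_sym (ltrans_dist_RP h) _ _.
- rewrite /ltrans_dists -big_split ler_sum// => h _.
  exact: RP_triangle (ltrans_dist_RP h) _ _ _.
- by apply: eq_bigr => h _; exact: RP_invariant (ltrans_dist_RP h) _ _ _.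
- elim: hs => [|h hs IH] p.
    under eq_fun do rewrite /ltrans_dists big_nil; exact: cvg_cst.
  under eq_fun do rewrite /ltrans_dists big_cons.
  apply: cvgD; [exact: RP_continuous (ltrans_dist_RP h) p|exact: IH].
Qed.

End TranslationDistance.

(** * Approximation of a measure by finite combinations of point masses *)

Section Discretization.
Variables (R : realType) (G : topologicalGroupType).
Local Notation Ub := (Ub R G).
Implicit Types (D : G -> G -> R) (f g h : Ub) (mu nu : norm_dual Ub).

Lemma Ub_sumE (T : finType) (F : T -> Ub) x :
  (\sum_t F t) x = \sum_t F t x.
Proof.
exact: (big_morph (fun f : Ub => f x)).
Qed.

(** The values of h lie in a bounded interval; colour x by the index of the cell
    of length e/2 that contains h x, and pair this with a colouring for the
    other functions. *)
Lemma finite_colouring (hs : seq Ub) (e : R) : 0 < e ->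
  exists (T : finType) (c : G -> T), forall x y, c x = c y ->
    \sum_(h <- hs) `|h x - h y| < e.
Proof.
elim: hs e => [|h hs IH] e e_gt0.
  by exists unit, (fun=> tt) => x y _; rewrite big_nil.
have e2 : 0 < e / 2 by rewrite divr_gt0.
have [T [c cP]] := IH _ e2.
pose b := `|h|; pose r x := (h x + b) / (e / 2).
have hb x : `|h x| <= b := Ub_norm_ge h x.
have r_ge0 x : 0 <= r x.
  by rewrite divr_ge0 ?(ltW e2)//; have := hb x; rewrite ler_norml; lra.
pose N := Num.truncn ((b + b) / (e / 2)).
have rN x : (Num.truncn (r x) <= N)%N.
  apply: le_truncn; rewrite ler_wpM2r ?invr_ge0 ?(ltW e2)//.
  by have := hb x; rewrite ler_norml; lra.
exists (T * 'I_N.+1)%type, (fun x => (c x, inord (Num.truncn (r x)))).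
move=> x y [cxy /(congr1 val)]; rewrite /= !inordK ?ltnS// => rxy.
rewrite big_cons [e]splitr ltrD//; last exact: cP.
have /andP[x1 x2] := truncn_itv (r_ge0 x).
have /andP[y1 y2] := truncn_itv (r_ge0 y).
have hr z : h z = r z * (e / 2) - b by rewrite /r divfK ?gt_eqF// addrK.
rewrite !hr opprB addrA subrK -mulrBl normrM (gtr0_norm e2) gtr_pMl//.
rewrite -natr1 in y2; rewrite rxy -natr1 in x1 x2.
by rewrite ltr_norml; apply/andP; split; lra.
Qed.

(** The tent functions u t = max(0, e - d(., y t)), where d(x, z) is the sum of
    |h x - h z| over hs and the y t represent the colours of a finite colouring,
    have a sum bounded away from 0, hence can be normalised.  The last clause says
    that |h x - h (y t)| <= e wherever phi t x is nonzero. *)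
Lemma partition_of_unity (hs : seq Ub) (e : R) : 0 < e ->
  exists (T : finType) (phi : T -> Ub) (y : T -> G),
  [/\ forall t x, 0 <= phi t x, forall x, \sum_t phi t x = 1 &
      forall t x h, h \in hs -> phi t x * `|h x - h (y t)| <= phi t x * e].
Proof.
move=> e_gt0; have e2 : 0 < e / 2 by rewrite divr_gt0.
have [T [c cP]] := finite_colouring hs e2.
(* A colour that no point has is represented by an arbitrary point, whose tent
   does no harm. *)
have [y yP] : exists y : T -> G, forall t x, t = c x -> c (y t) = c x.
  apply: (@fin_all_exists T (fun=> G)
    (fun t z => forall x, t = c x -> c z = c x)) => t.
  by case: (pselect (exists x, t = c x)) => [[x ->]|ne];
    [exists x|exists 1%g => x tx; case: ne; exists x].
pose d t x := \sum_(h <- hs) `|h x - h (y t)|.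
pose u t x := Num.max 0 (e - d t x).
pose s x := \sum_t u t x.
have u_ge0 t x : 0 <= u t x by rewrite le_max lexx.
have u_les t x : u t x <= s x.
  by rewrite /s (bigD1 t)//= lerDl sumr_ge0.
have s_gt x : e / 2 < s x.
  apply: lt_le_trans (u_les (c x) x); rewrite lt_max; apply/orP; right.
  by rewrite ltrBrDr -ltrBrDl {1}[e]splitr addrK; apply: cP; rewrite (yP _ x).
have s_gt0 x : 0 < s x by apply: lt_trans (s_gt x).
have uL t x z : `|u t x - u t z| <= ltrans_dists hs x z.
  have dL : `|d t x - d t z| <= ltrans_dists hs x z.
    rewrite /d -sumrB (le_trans (ler_norm_sum _ _ _))// ler_sum// => h _.
    apply: le_trans (ler_dist_dist _ _) _; rewrite opprB addrA subrK.
    exact: ltrans_dist_ge.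
  apply: le_trans dL; rewrite /u /Num.max !subr_gt0.
  by case: ltP => ?; case: ltP => ?; rewrite ler_norml; apply/andP; split;
    case: (ger0P (d t x - d t z)); lra.
have sL x z : `|s x - s z| <= #|T|%:R * ltrans_dists hs x z.
  rewrite /s -sumrB (le_trans (ler_norm_sum _ _ _))//.
  rewrite (le_trans (ler_sum _ (fun t _ => uL t x z)))//.
  by rewrite sumr_const mulr_natl.
have phi_le1 t x : u t x / s x <= 1 by rewrite ler_pdivrMr// mul1r.
have phi_ge0 t x : 0 <= u t x / s x by rewrite divr_ge0// ltW.
have phiU t : (fun x => u t x / s x) \in @Ub_pred R G.
  apply: (@Ub_lipschitz _ _ (ltrans_dists hs) _ 1 ((1 + #|T|%:R) / (e / 2))).
  - exact: ltrans_dists_RP.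
  - by rewrite divr_ge0// ltW.
  - by move=> x; rewrite ger0_norm.
  move=> x z; have D0 := RP_ge0 (ltrans_dists_RP hs) x z.
  have -> : u t x / s x - u t z / s z =
      ((u t x - u t z) + u t z / s z * (s z - s x)) / s x.
    by field; rewrite !gt_eqF.
  rewrite normrM (gtr0_norm (x := (s x)^-1)) ?invr_gt0//.
  rewrite [leRHS]mulrAC ler_pM ?normr_ge0 ?invr_ge0 ?(ltW (s_gt0 x))//.
    rewrite mulrDl mul1r (le_trans (ler_normD _ _))// lerD//.
    rewrite normrM ger0_norm// distrC (le_trans _ (sL x z))//.
    by rewrite ler_piMl.
  by rewrite lef_pV2 ?posrE// ltW.
exists T, (fun t => MkUb (phiU t)), y; split=> /= [//|x|t x h hhs].
  by rewrite -mulr_suml -/(s x) divff// gt_eqF.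
have [du|du] := ltP (d t x) e; last first.
  by rewrite /u (max_idPl _) ?subr_le0// !mul0r.
rewrite ler_wpM2l// (le_trans _ (ltW du))// /d (perm_big _ (perm_to_rem hhs)).
by rewrite big_cons lerDl sumr_ge0.
Qed.

(** The error nu - \sum_t a t delta_(y t) of an approximation, as a measure. *)
Definition residual_val nu (T : finType) (a : T -> R) (y : T -> G) f : R :=
  nu f - \sum_t a t * f (y t).

Section Residual.
Variables (nu : norm_dual Ub) (T : finType) (a : T -> R) (y : T -> G).

Fact residual_linear : linear (residual_val nu a y).
Proof.
move=> k f g; rewrite /residual_val linearP.
have -> : \sum_t a t * (k *: f + g) (y t) =
    k * (\sum_t a t * f (y t)) + \sum_t a t * g (y t).
  rewrite mulr_sumr -big_split; apply: eq_bigr => t _ /=.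
  by rewrite -[X in _ * X]/(k * f (y t) + g (y t)); ring.
by rewrite -[k *: _]/(k * _) -[k *: _]/(k * _); ring.
Qed.

HB.instance Definition _ :=
  GRing.isLinear.Build R Ub R *:%R (residual_val nu a y) residual_linear.

Fact residual_continuous : continuous (residual_val nu a y).
Proof.
have [c c_ge0 nuc] := dual_bound nu.
apply: (@bounded_dual _ _ _ (c + \sum_t `|a t|)) => f.
rewrite mulrDl (le_trans (ler_normB _ _))// lerD// mulr_suml.
rewrite (le_trans (ler_norm_sum _ _ _))// ler_sum// => t _.
by rewrite normrM ler_wpM2l//; exact: Ub_norm_ge.
Qed.

Definition residual : norm_dual Ub := MkDual residual_continuous.

End Residual.

Lemma convol_residual mu nu (T : finType) (a : T -> R) (y : T -> G) f :
  convol R G mu (residual nu a y) f =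
  convol R G mu nu f - \sum_t a t * convol R G mu (delta_dual R (y t)) f.
Proof.
rewrite -[LHS]/(mu (lconvol (residual nu a y) f)).
have -> : lconvol (residual nu a y) f =
    lconvol nu f - \sum_t a t *: lconvol (delta_dual R (y t)) f.
  apply/val_inj/funext => x.
  rewrite -[RHS]/(nu (ltrans f x) -
    Ub_val (\sum_t a t *: lconvol (delta_dual R (y t)) f) x).
  by rewrite Ub_sumE.
rewrite linearB linear_sum; congr (_ - _).
by apply: eq_bigr => t _; rewrite linearZ.
Qed.

(** The masses nu (phi t) work: \sum_t nu (phi t) f (y t) is the value of nu at
    the interpolation \sum_t f (y t) phi t, whose norm is at most the norm of f
    and which is uniformly close to f for the f in hs. *)
Lemma discretization nu (b : R) (hs : seq Ub) (e : R) : 0 < e ->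
    0 <= b -> (forall f, `|nu f| <= b * `|f|) ->
  exists (T : finType) (a : T -> R) (y : T -> G),
    (forall f, `|residual nu a y f| <= (b + b) * `|f|) /\
    forall h, h \in hs -> `|residual nu a y h| < e.
Proof.
move=> e_gt0 b_ge0 nub.
have b1 : 0 < b + 1 by rewrite ltr_wpDl.
have [|T [phi [y [phi_ge0 phi1 phiy]]]] := @partition_of_unity hs (e / (b + 1)).
  by rewrite divr_gt0.
exists T, (fun t => nu (phi t)), y.
have sumE f : \sum_t nu (phi t) * f (y t) = nu (\sum_t f (y t) *: phi t).
  by rewrite linear_sum; apply: eq_bigr => t _; rewrite linearZ mulrC.
split=> [f|h hhs].
  rewrite mulrDl (le_trans (ler_normB _ _))// lerD// sumE.
  rewrite (le_trans (nub _))// ler_wpM2l//; apply: Ub_norm_le => x.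
  rewrite Ub_sumE (le_trans (ler_norm_sum _ _ _))//.
  rewrite -[leRHS]mul1r -(phi1 x) mulr_suml ler_sum// => t _.
  rewrite -[X in `|X|]/(f (y t) * phi t x) normrM mulrC ger0_norm//.
  by rewrite ler_wpM2l//; exact: Ub_norm_ge.
rewrite -[X in `|X|]/(nu h - _) sumE -linearB (le_lt_trans (nub _))//.
rewrite (@le_lt_trans _ _ (b * (e / (b + 1))))//; last first.
  by rewrite mulrCA gtr_pMr// ltr_pdivrMr// mul1r ltrDl.
rewrite ler_wpM2l//; move: (e / (b + 1)) phiy => d phiy.
apply: Ub_norm_le => x.
rewrite -[X in `|X|]/(h x - Ub_val (\sum_t h (y t) *: phi t) x) Ub_sumE.
rewrite -[h x]mul1r -(phi1 x) mulr_suml -sumrB.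
rewrite (le_trans (ler_norm_sum _ _ _))// -[leRHS]mul1r -(phi1 x) mulr_suml.
apply: ler_sum => t _; rewrite -[X in _ - X]/(h (y t) * phi t x).
by rewrite [X in _ - X]mulrC -mulrBr normrM ger0_norm// phiy.
Qed.

End Discretization.

(** * Uniformly continuous measures are central *)

Section MuCentre.
Variables (R : realType) (G : topologicalGroupType).
Local Notation Ub := (Ub R G).
Implicit Types (D : G -> G -> R) (f g h k : Ub) (mu nu : norm_dual Ub).

Fact half_subproof : (fun _ : G => 1 / 2 : R) \in @Ub_pred R G.
Proof.
apply: (@Ub_lipschitz _ _ (fun _ _ => 0) _ (1 / 2) 0) => //; first exact: RP0.
  by move=> _; rewrite ger0_norm.
by move=> *; rewrite subrr normr0 mul0r.
Qed.

(** The centre of the cube [0, 1]^G: a small multiple of a bounded Lipschitz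
    function of arbitrary sign can be added to it without leaving BLip. *)
Definition half : Ub := MkUb half_subproof.

(** Continuity of mu at the constant function 1/2 of BLip D, transported to 0 by
    k |-> 1/2 + k / (2c).  By linearity this one point yields uniform
    continuity. *)
Lemma Mu_small mu D (c e : R) : Mu R G mu -> RP D -> 0 < c -> 0 < e ->
  exists (xs : seq G) (d : R), 0 < d /\ forall k,
    (forall x, `|k x| <= c) -> (forall x y, `|k x - k y| <= c * D x y) ->
    (forall x, x \in xs -> `|k x| < d) -> `|mu k| < e.
Proof.
move=> Mmu dD c_gt0 e_gt0.
pose W : set Ub := [set f : Ub | BLip D f].
(* F is the trace on Ub of the pointwise neighbourhoods of 1/2, given by an
   explicit basis so that the finite set of points can be extracted. *)
pose B (p : seq G * R) : set Ub :=
  [set k | forall x, x \in p.1 -> `|k x - 1 / 2| < p.2].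
pose F : set_system Ub := filter_from [set p : seq G * R | 0 < p.2] B.
have FF : Filter F.
  apply: filter_from_filter; first by exists ([::], 1) => /=.
  move=> [xs d] [ys e'] /= d_gt0 e'_gt0; exists (xs ++ ys, Num.min d e').
    by rewrite /= lt_min d_gt0.
  move=> k kd; split=> x xxs; have := kd x; rewrite /= mem_cat xxs ?orbT lt_min;
    by move=> /(_ isT)/andP[].
have Fhalf : F --> (half : initial_topology (@Ub_ptws R G)).
  move=> A [_ [[V Vop <-] Vhalf sVA]].
  have : {ptws, (@Ub_ptws R G) @ F --> (fun _ : G => 1 / 2 : R)}.
    apply/pointwise_cvgP => x; apply/cvgrPdist_lt => r r_gt0.
    exists ([:: x], r) => //= k /(_ x); rewrite /= mem_head distrC; exact.
  move=> /(_ V (open_nbhs_nbhs (conj Vop Vhalf))) FV.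
  exact: filterS sVA FV.
have Whalf : W half.
  by split=> [x|x y] /=; rewrite ?subrr ?normr0 ?(RP_ge0 dD)//; lra.
have /subspace_continuousP/(_ half Whalf) muW := Mmu D dD.
have : (mu : Ub -> R) @ within W F --> mu half.
  apply: cvg_trans muW; apply: cvg_app.
  by move=> A; exact: Fhalf.
have c2 : 0 < 2 * c by rewrite mulr_gt0.
move=> /cvgrPdist_lt/(_ (e / (2 * c))) []; first by rewrite divr_gt0.
move=> [xs d] /= d_gt0 Bd; exists xs, (2 * c * d).
split=> [|k kc kD kd]; first by rewrite mulr_gt0.
pose k' : Ub := half + (2 * c)^-1 *: k.
have k'E x : k' x = 1 / 2 + (2 * c)^-1 * k x by [].
have i2c : 0 <= (2 * c)^-1 by rewrite invr_ge0 ltW.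
have := Bd k'; rewrite /= linearD linearZ /= opprD addrA subrr add0r normrN.
rewrite -[_ *: _]/(_ * _) normrM (ger0_norm i2c) mulrC ltr_pM2r ?invr_gt0//.
apply.
  move=> x xxs; rewrite k'E addrC addKr normrM (ger0_norm i2c).
  by rewrite ltr_pdivrMl// kd.
split=> [x|x y]; rewrite !k'E.
  have : `|(2 * c)^-1 * k x| <= 1 / 2.
    rewrite normrM (ger0_norm i2c) ler_pdivrMl// (le_trans (kc x))//; lra.
  by rewrite ler_norml => /andP[? ?]; apply/andP; split; lra.
rewrite opprD addrACA subrr add0r -mulrBr normrM (ger0_norm i2c) ler_pdivrMl//.
rewrite (le_trans (kD x y))// -mulrA.
rewrite ler_peMl ?mulr_ge0 ?(RP_ge0 dD) ?(ltW c_gt0)//.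
by lra.
Qed.

Lemma lconvol_le nu (b : R) f x : (forall v, `|nu v| <= b * `|v|) ->
  0 <= b -> `|lconvol nu f x| <= b * `|f|.
Proof.
move=> nub b_ge0; apply: le_trans (nub _) _; rewrite ler_wpM2l//.
by apply: Ub_norm_le => y; exact: Ub_norm_ge f (x * y)%g.
Qed.

Lemma lconvol_lip nu (b : R) f x y : (forall v, `|nu v| <= b * `|v|) ->
  `|lconvol nu f x - lconvol nu f y| <= b * ltrans_dist f x y.
Proof.
move=> nub; rewrite -[X in `|X|]/(nu (ltrans f x) - nu (ltrans f y)) -linearB.
exact: nub.
Qed.

(** For nu bounded by b, lconvol nu f ranges over functions with common bounds
    and a common Lipschitz constant for ltrans_dist f, and its value at x is
    nu (ltrans f x); so Mu_small applies. *)
Lemma convol_small mu f (b e : R) : Mu R G mu -> 0 <= b -> 0 < e ->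
  exists (xs : seq G) (d : R), 0 < d /\ forall nu,
    (forall v, `|nu v| <= b * `|v|) ->
    (forall x, x \in xs -> `|nu (ltrans f x)| < d) -> `|convol R G mu nu f| < e.
Proof.
move=> Mmu b_ge0 e_gt0; have b1 : 0 < b + 1 by rewrite ltr_wpDl.
have f1 : 0 < `|f| + 1 by rewrite ltr_wpDl.
have [|xs [d [d_gt0 xsd]]] :=
  @Mu_small _ _ ((b + 1) * (`|f| + 1)) _ Mmu (ltrans_dist_RP f) _ e_gt0.
  by rewrite mulr_gt0.
exists xs, d; split=> // nu nub nud; apply: xsd => [x|x y|x /nud//].
  by rewrite (le_trans (lconvol_le _ _ nub _))// ler_pM// lerDl.
rewrite (le_trans (lconvol_lip _ _ _ nub))// ler_wpM2r ?normr_ge0//.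
by rewrite -[leLHS]mulr1 ler_pM// ?lerDl ?lerDr.
Qed.

Definition rconvol_val mu f (y : G) : R := convol R G mu (delta_dual R y) f.

Lemma delta_dual_le (y : G) f : `|delta_dual R y f| <= 1 * `|f|.
Proof. by rewrite mul1r; exact: Ub_norm_ge. Qed.

(** Uniform continuity comes from convol_small at the measures
    delta_y - delta_z, which are bounded by 2. *)
Lemma rconvol_subproof mu f : Mu R G mu -> rconvol_val mu f \in @Ub_pred R G.
Proof.
move=> Mmu; have [c c_ge0 muc] := dual_bound mu.
apply/Ub_predP; split; last first.
  exists (c * `|f|) => y; rewrite (le_trans (muc _))// ler_wpM2l//.
  apply: Ub_norm_le => x; rewrite -[leRHS]mul1r.
  exact: lconvol_le (delta_dual_le y) _.
apply/rG_unif_continuousP => e e_gt0.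
have [xs [d [d_gt0 xsd]]] := @convol_small _ f 2 _ Mmu (ler0n _ _) e_gt0.
exists (ltrans_dists [seq ltrans f x | x <- xs]), d.
  by split=> //; exact: ltrans_dists_RP.
move=> y z yz.
have /= := xsd (residual (delta_dual R y) (fun=> 1) (fun _ : unit => z)).
rewrite convol_residual (big_pred1 tt) ?mul1r; last by case.
apply=> [v|x xxs]; rewrite /residual_val (big_pred1 tt) ?mul1r; try by case.
  rewrite (le_trans (ler_normB _ _))// mulr_natl mulr2n lerD//;
    exact: Ub_norm_ge.
apply: le_lt_trans yz; apply: le_trans (ltrans_dist_ge (ltrans f x) y z) _.
rewrite /ltrans_dists big_map (perm_big _ (perm_to_rem xxs)) big_cons lerDl.
by apply: sumr_ge0 => w _; exact: normr_ge0.
Qed.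

Definition rconvol mu f (Mmu : Mu R G mu) : Ub := MkUb (rconvol_subproof f Mmu).

(** The two sides agree on point masses, hence differ only by their values at
    the residual of a discretization of nu.  That residual is bounded by 2b and
    is made small at rconvol f and at the finitely many translates of f to which
    convol_small is sensitive. *)
Lemma convolE mu nu f (Mmu : Mu R G mu) :
  convol R G mu nu f = nu (rconvol f Mmu).
Proof.
have [b b_ge0 nub] := dual_bound nu.
apply/eqP; rewrite -subr_eq0 -normr_le0; apply/ler_addgt0Pr => e e_gt0.
rewrite add0r; have e2 : 0 < e / 2 by rewrite divr_gt0.
have [|xs [d [d_gt0 xsd]]] := @convol_small _ f (b + b) _ Mmu _ e2.
  by rewrite addr_ge0.
have de : 0 < Num.min d (e / 2) by rewrite lt_min d_gt0.
have [T [a [y [resb ress]]]] := @discretization _ _ nu b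
  (rconvol f Mmu :: [seq ltrans f x | x <- xs]) _ de b_ge0 nub.
have : `|convol R G mu (residual nu a y) f| < e / 2.
  apply: xsd => // x xxs.
  have := ress (ltrans f x); rewrite inE map_f ?orbT//.
  by move=> /(_ isT); rewrite lt_min => /andP[].
have := ress _ (mem_head _ _); rewrite lt_min => /andP[_].
pose S := \sum_t a t * rconvol f Mmu (y t).
have -> : residual nu a y (rconvol f Mmu) = nu (rconvol f Mmu) - S by [].
have -> : convol R G mu (residual nu a y) f = convol R G mu nu f - S.
  exact: convol_residual.
rewrite !ltr_norml ler_norml => /andP[? ?] /andP[? ?]; apply/andP; split; lra.
Qed.

Lemma Mu_convol_continuous mu : Mu R G mu -> continuous (convol R G mu).
Proof.
move=> Mmu; apply: dual_continuousP => f.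
under eq_fun do rewrite (convolE _ _ Mmu).
exact: dual_eval_continuous.
Qed.

End MuCentre.

(** * Weak* compactness of the dual unit ball *)

Section Alaoglu.
Variables (R : realType) (V : normedModType R).

Lemma closed_linear : closed [set p : {ptws V -> R} | linear p].
Proof.
have ev (v : V) : continuous (fun p : {ptws V -> R} => p v).
  exact: (@proj_continuous _ (fun _ => R) v).
have -> : [set p : {ptws V -> R} | linear p] = \bigcap_(i in [set: R * V * V])
    ((fun p : {ptws V -> R} =>
      p (i.1.1 *: i.1.2 + i.2) - (i.1.1 * p i.1.2 + p i.2)) @^-1` [set 0]).
  apply/seteqP; split=> [p lp [[a u] v] _ /=|p lp a u v].
    by rewrite lp subrr.
  by apply/eqP; rewrite -subr_eq0; apply/eqP; exact: (lp (a, u, v)).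
have combC (T : topologicalType) (a : R) (p q r : T -> R) :
    continuous p -> continuous q -> continuous r ->
    continuous (fun t => p t - (a * q t + r t)).
  move=> cp cq cr t; apply: cvgB; first exact: cp.
  by apply: cvgD; [apply: cvgM; [exact: cvg_cst|exact: cq]|exact: cr].
apply: closed_bigI => -[[a u] v] _ /=.
have /continuous_closedP/(_ [set 0]) :=
  combC _ a _ _ _ (ev (a *: u + v)) (ev u) (ev v).
by move=> /(_ (@closed_eq R 0)).
Qed.

(** The ball is the set of linear points of a product of compact intervals, and
    linearity is a pointwise closed condition: a cluster point in the product is
    again a measure. *)
Lemma dual_ball_compact :
  compact [set mu : norm_dual V | forall v, `|mu v| <= `|v|].
Proof.
move=> F FF FB.
pose box := [set p : {ptws V -> R} | forall v, `[- `|v|, `|v|]%classic (p v)].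
have boxC : compact box.
  exact: (@tychonoff V (fun=> R) (fun v => `[- `|v|, `|v|]%classic)
    (fun v => @segment_compact R _ _)).
have Fbox : (@dual_ptws R V @ F) box.
  apply: (@filterS _ F _
    [set mu : norm_dual V | forall v, `|mu v| <= `|v|]) => //.
  by move=> mu muB v; have := muB v; rewrite /= in_itv /= ler_norml.
have [p [pbox pF]] := boxC (@dual_ptws R V @ F) _ Fbox.
have pl : linear (p : V -> R).
  have FL : (@dual_ptws R V @ F) [set q : {ptws V -> R} | linear q].
    by apply: (@filterE _ F) => mu /= a u v; exact: (linearP (dual_val mu)).
  by apply: closed_linear => A pA; exact: (pF _ _ FL pA).
pose L : {linear V -> R} :=
  HB.pack (p : V -> R) (GRing.isLinear.Build R V R *:%R (p : V -> R) pl).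
have Lb v : `|L v| <= 1 * `|v|.
  by have := pbox v; rewrite mul1r /= in_itv /= -ler_norml.
exists (MkDual (bounded_dual Lb)); split=> [v|A B FA].
  by rewrite -[leRHS]mul1r; exact: Lb.
move=> [_ [[U Uop <-] Up sUB]].
have [_ [[mu Amu <-] Umu]] := pF (@dual_ptws R V @` A) U
  (filterS (@preimage_image _ _ _ _) FA) (open_nbhs_nbhs (conj Uop Up)).
by exists mu; split=> //; exact: sUB.
Qed.

End Alaoglu.

(** * Central measures on an ambitable group are uniformly continuous *)

Section CentreMu.
Variables (R : realType) (G : topologicalGroupType).
Local Notation Ub := (Ub R G).
Implicit Types (D : G -> G -> R) (f g h k : Ub) (mu nu : norm_dual Ub).

Lemma rG_bar_compact : compact (@rG_bar R G).
Proof.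
apply: subclosed_compact (@dual_ball_compact R Ub) _.
  exact: closed_closure.
have clB : closed [set mu : norm_dual Ub | forall v, `|mu v| <= `|v|].
  have -> : [set mu : norm_dual Ub | forall v, `|mu v| <= `|v|] =
      \bigcap_(v in [set: Ub])
        ((fun mu : norm_dual Ub => `|mu v|) @^-1` [set x | x <= `|v|]).
    by apply/seteqP; split=> [mu muB v _|mu muB v]; exact: muB.
  apply: closed_bigI => v _.
  have /continuous_closedP/(_ [set x | x <= `|v|]) :
      continuous (fun mu : norm_dual Ub => `|mu v|).
    move=> mu; apply: (@continuous_comp _ _ _ (fun mu : norm_dual Ub => mu v)).
      exact: dual_eval_continuous.
    exact: norm_continuous.
  by move=> /(_ (@closed_le R _)).
rewrite /rG_bar closureE => mu; apply; split=> // _ [x _ <-] v.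
exact: Ub_norm_ge.
Qed.

Definition lconvol_ptws f nu : {ptws G -> R} := lconvol nu f : G -> R.

Lemma lconvol_ptws_continuous f : continuous (lconvol_ptws f).
Proof.
move=> nu.
apply/(@pointwise_cvgP G R (lconvol_ptws f @ nbhs nu) (lconvol nu f)) => x.
exact: (@dual_eval_continuous _ _ (ltrans f x)).
Qed.

Lemma ptws_hausdorff : hausdorff_space {ptws G -> R}.
Proof. by apply: hausdorff_product => _; exact: Rhausdorff. Qed.

Lemma lconvol_ptws_closed f (A : set (norm_dual Ub)) : compact A ->
  closed (lconvol_ptws f @` A).
Proof.
move=> cA; apply: compact_closed; first exact: ptws_hausdorff.
apply: continuous_compact cA; apply: continuous_subspaceT.
exact: lconvol_ptws_continuous.
Qed.

(** lconvol (delta_dual x) f = rho x f, and the image of rG_bar is closed. *)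
Lemma closure_right_orbit f :
  closure (right_orbit f : set {ptws G -> R}) `<=`
    lconvol_ptws f @` @rG_bar R G.
Proof.
have := @lconvol_ptws_closed f _ rG_bar_compact; rewrite closure_id => ->.
apply: closure_subset => _ [x _ <-]; exists (delta_dual R x) => //.
by apply: subset_closure; exists x.
Qed.

(** Let h be in BLip D.  The measures nu in rG_bar at which mu (lconvol nu f) is
    e-far from mu h form a compact set C, so that its image under nu |-> lconvol
    nu f is closed; the image omits h.  Its complement is the neighbourhood of h
    on which mu is e-close to mu h. *)
Lemma convol_continuous_Mu mu : ambitable R G ->
  {within @rG_bar R G, continuous (convol R G mu)} -> Mu R G mu.
Proof.
move=> ambG cmu D dD; have [f Df] := ambG D dD.
apply/subspace_continuousP => h Dh; apply/cvgrPdist_lt => e e_gt0.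
pose C := [set nu | @rG_bar R G nu /\ e <= `|mu h - convol R G mu nu f|].
have cC : compact C.
  have cphi : {within @rG_bar R G, continuous (fun nu => convol R G mu nu f)}.
    move=> nu; apply: (@continuous_comp _ _ _
      (convol R G mu : subspace (@rG_bar R G) -> norm_dual Ub)
      (fun la : norm_dual Ub => la f)); first exact: cmu.
    exact: dual_eval_continuous.
  have /continuous_closedP/(_ [set x | e <= `|mu h - x|]) := cphi.
  move=> /(_ _)/closed_subspaceP[].
    have /continuous_closedP/(_ [set x | e <= x]) :
        continuous (fun x : R => `|mu h - x|).
      move=> x; apply: cvg_norm; apply: cvgB; [exact: cvg_cst|exact: cvg_id].
    by move=> /(_ (@closed_ge R _)).
  move=> V Vcl VE; apply: (@subclosed_compact _ _ (@rG_bar R G)).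
  - have -> : C = V `&` @rG_bar R G.
      by rewrite VE; apply/seteqP; split=> nu [].
    by apply: closedI => //; exact: closed_closure.
  - exact: rG_bar_compact.
  - by move=> nu [].
have hC : ~ (lconvol_ptws f @` C) (Ub_ptws h).
  move=> [nu [rnu]] + /= hE.
  have -> : convol R G mu nu f = mu h by congr (mu _); exact/val_inj.
  by rewrite subrr normr0 leNgt e_gt0.
have : nbhs (Ub_ptws h) (~` (lconvol_ptws f @` C)).
  apply: open_nbhs_nbhs; split=> //; apply: closed_openC.
  exact: lconvol_ptws_closed.
move=> /(@initial_continuous _ _ (@Ub_ptws R G) h) near_h.
suff : nbhs h [set k : initial_topology (@Ub_ptws R G) |
    BLip D k -> `|mu h - mu k| < e] by [].
apply: (@filterS _ (nbhs (h : initial_topology (@Ub_ptws R G))) _ _ _ _ near_h).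
move=> k kC Dk.
have [nu rnu nuk] := closure_right_orbit (Df _ Dk).
have -> : k = lconvol nu f by apply/val_inj.
by rewrite ltNge; apply/negP => le_e; apply: kC; exists nu.
Qed.

End CentreMu.

Theorem corollary5p4 (R : realType) (G : topologicalGroupType)
    (hausdorffG : hausdorff_space G) (ambitableG : ambitable R G) :
  (@Mu R G = topological_centre (@convol R G) [set: norm_dual (Ub R G)]
  /\ @rG_hat R G = topological_centre (@convol R G) (@rG_bar R G))%classic.
Proof.
split; apply/seteqP; split=> mu.
- move=> Mmu; split=> //; apply: continuous_subspaceT.
  exact: Mu_convol_continuous.
- move=> [_ cmu]; apply: convol_continuous_Mu => //.
  by apply: continuous_subspaceW cmu.
- move=> [rmu Mmu]; split=> //; apply: continuous_subspaceT.
  exact: Mu_convol_continuous.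
- by move=> [rmu cmu]; split=> //; exact: convol_continuous_Mu.
Qed.
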